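(* Let $\phi, \phi' \in L^1(\mathbb{R}_+)$ with $\int_0^\infty\phi = \int_0^\infty\phi' = 1$, and let $I_{\phi}$ and $I_{\phi'}$ be the closed ideals in $L^1(\mathbb{R})$ generated by $\tilde{\phi}$ and $\tilde{\phi'}$ respectively. If $I_{\phi} \subseteq I_{\phi'}$, then $S_{\phi}$ is stronger than $S_{\phi'}$.
   Context: $\mathbb{R}_+ = [0,\infty)$; functions are complex-valued. $S_{\phi}(f) = \lim_{x\to\infty}\int_0^x f(t)\phi(x-t)\,dt$ for $f\in L^\infty(\mathbb{R}_+)$, with domain $\mathcal{D}(S_\phi)$ the set of $f$ for which the limit exists. $S$ is stronger than $S'$ if $\mathcal{D}(S')\subseteq\mathcal{D}(S)$ and $S = S'$ on $\mathcal{D}(S')$. $\tilde{\phi}\in L^1(\mathbb{R})$ equals $\phi$ on $[0,\infty)$ and $0$ on $(-\infty,0)$; $L^1(\mathbb{R})$ is the convolution Banach algebra. *)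

(* Defs.v *)
From HB Require Import structures.
From mathcomp Require Import all_boot all_order all_algebra.
From mathcomp Require Import all_classical all_reals all_analysis.
From mathcomp Require Import complex.
Set Implicit Arguments. Unset Strict Implicit. Unset Printing Implicit Defensive.
Import Order.TTheory GRing.Theory Num.Theory.
Import numFieldNormedType.Exports.
Local Open Scope classical_set_scope.
Local Open Scope ring_scope.

Section Defs.
Variable R : realType.
Local Notation C := (R[i])%C.
Local Notation mu := (@lebesgue_measure R).

Definition cabs (z : C) : R := Num.sqrt (complex.Re z ^+ 2 + complex.Im z ^+ 2).

Definition L1 (D : set R) (f : R -> C) : Prop :=
  mu.-integrable D (fun x => (complex.Re (f x))%:E) /\
  mu.-integrable D (fun x => (complex.Im (f x))%:E).

Definition cint (D : set R) (f : R -> C) : C :=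
  ((Rintegral mu D (fun x => complex.Re (f x)))%:C +
   'i * (Rintegral mu D (fun x => complex.Im (f x)))%:C)%C.

Definition norm1 (f : R -> C) : R := Rintegral mu setT (fun x => cabs (f x)).

(* convolution in L^1(R) (pointwise formula; correct almost everywhere) *)
Definition conv (f g : R -> C) (x : R) : C := cint setT (fun t => f t * g (x - t)).

(* closed ideals of the convolution Banach algebra L^1(R), as sets of functions
   (closedness makes them saturated under a.e. equality) *)
Definition closed_ideal (J : set (R -> C)) : Prop :=
  [/\ (forall f, J f -> L1 setT f),
      J (fun _ => 0),
      (forall (a : C) f g, J f -> J g -> J (fun x => a * f x + g x)),
      (forall f g h, J f -> L1 setT g -> L1 setT h ->
          {ae mu, forall x, h x = conv g f x} -> J h) &
      (forall h, L1 setT h ->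
          (forall e : R, 0 < e -> exists2 f, J f & norm1 (fun x => h x - f x) < e) ->
          J h)].

Definition gen_ideal (f : R -> C) : set (R -> C) :=
  fun h => forall J, closed_ideal J -> J f -> J h.

Definition ext0 (phi : R -> C) (x : R) : C := if 0 <= x then phi x else 0.

Definition Linf_pos (f : R -> C) : Prop :=
  measurable_fun `[(0:R), +oo[%classic (fun x => complex.Re (f x)) /\
  measurable_fun `[(0:R), +oo[%classic (fun x => complex.Im (f x)) /\
  exists M : R, {ae mu, forall x, `[(0:R), +oo[%classic x -> cabs (f x) <= M}.

Definition Sconv (phi f : R -> C) (x : R) : C :=
  cint `[0, x] (fun t => f t * phi (x - t)).

Definition Ssum (phi f : R -> C) (l : C) : Prop :=
  (complex.Re (Sconv phi f x) : R) @[x --> +oo] --> (complex.Re l : R) /\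
  (complex.Im (Sconv phi f x) : R) @[x --> +oo] --> (complex.Im l : R).

(* S_phi is stronger than S_phi': D(S_phi') ⊆ D(S_phi) and S_phi = S_phi' on D(S_phi') *)
Definition stronger (phi phi' : R -> C) : Prop :=
  forall f, Linf_pos f -> forall l, Ssum phi' f l -> Ssum phi f l.

End Defs.

(* Main.v *)
(** Replace the bounded function [f] by an everywhere bounded function [b] that
    vanishes on the negative half-line, so that the [phi]-mean of [f] at [x] is
    [(phi * b)(x)], the convolution over the whole line of the extension by
    zero of [phi] with [b].  The functions [h] of [L^1] such that [(h * b)(x)]
    tends to [l * int h] form a closed ideal: for [h = f * g] one has
    [h * b = g * (f * b)] by Fubini, and dominated convergence gives the limit
    [int g * (l * int f) = l * int h]; closedness is the estimate
    [|h * b| <= 2 M ||h||_1].  If [S_phi'] sums [f] to [l], this ideal contains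
    [phi'], hence the closed ideal generated by [phi'], hence [phi]. *)

Require Import Defs.
From HB Require Import structures.
From mathcomp Require Import all_boot all_order all_algebra.
From mathcomp Require Import all_classical all_reals all_analysis.
From mathcomp Require Import measurable_realfun complex ring.
Import Order.TTheory GRing.Theory Num.Theory.
Import numFieldNormedType.Exports.
Local Open Scope classical_set_scope.
Local Open Scope ring_scope.

(** * Translations and reflections preserve Lebesgue integrals *)

Section measure_preserving.
Context {R : realType}.
Local Notation mu := (@lebesgue_measure R).
(* The domain of [lebesgue_measure]; it is convertible to the measurable type
   inferred for [R], but unification does not identify the two displays. *)
Local Notation RT := (measurableTypeR R).
Variable phi : RT -> RT.
Hypothesis mphi : measurable_fun setT phi.
Hypothesis phi_itv : forall a b : R, mu (phi @^-1` `]a, b]) = mu `]a, b].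

(** Bundling [phi] lets [pushforward mu phi_mfun] be inferred as a measure, as the uniqueness
    theorem for Lebesgue measure requires. *)
Let phi_mfun : {mfun measurableTypeR R >-> measurableTypeR R} :=
  HB.pack phi
    (isMeasurableFun.Build _ _ _ _ _ mphi).

(** The pushforward is a measure agreeing with [mu] on half-open intervals, and these determine
    Lebesgue measure on all measurable sets. *)
Lemma lebesgue_measure_preimage (A : set R) :
  measurable A -> pushforward mu phi A = mu A.
Proof.
move=> mA; apply/esym.
apply: (@lebesgue_measure_unique R (pushforward mu phi_mfun)) => //.
by move=> _ [[a b]] _ <-; rewrite /= /pushforward phi_itv.
Qed.

Local Open Scope ereal_scope.

Lemma ge0_integral_comp_preserving (f : RT -> \bar R) :
  measurable_fun setT f -> (forall x, 0 <= f x) ->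
  \int[mu]_x f (phi x) = \int[mu]_x f x.
Proof.
move=> mf f0.
have := @ge0_integral_pushforward _ _ _ _ R _ mphi mu setT f measurableT mf
  (fun y _ => f0 y).
rewrite preimage_setT => <-.
rewrite -[pushforward mu phi]/(pushforward mu phi_mfun).
apply: eq_measure_integral => A mA _.
exact: lebesgue_measure_preimage.
Qed.

Lemma integrable_comp_preserving (f : RT -> \bar R) :
  mu.-integrable setT f -> mu.-integrable setT (f \o phi).
Proof.
move=> /integrableP[mf fi]; apply/integrableP; split.
  exact: measurableT_comp.
rewrite (ge0_integral_comp_preserving (abse \o f)) => [//||x].
- exact: measurableT_comp.
- exact: abse_ge0.
Qed.

Lemma integral_comp_preserving (f : RT -> \bar R) :
  mu.-integrable setT f -> \int[mu]_x f (phi x) = \int[mu]_x f x.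
Proof.
move=> fi; have /integrableP[mf _] := fi.
have := @integral_pushforward _ _ _ _ R _ mphi mu setT f mf.
rewrite preimage_setT => /(_ (integrable_comp_preserving _ fi) measurableT) <-.
rewrite -[pushforward mu phi]/(pushforward mu phi_mfun).
apply: eq_measure_integral => A mA _.
exact: lebesgue_measure_preimage.
Qed.

End measure_preserving.

Section shift_reflect.
Context {R : realType}.
Local Notation mu := (@lebesgue_measure R).

Lemma measurable_subr (c : R) : measurable_fun setT (fun t : R => c - t).
Proof. exact: measurable_funB. Qed.

Lemma measurable_subl (c : R) : measurable_fun setT (fun t : R => t - c).
Proof. exact: measurable_funB. Qed.

Lemma lebesgue_measure_shift (c a b : R) :
  mu ((fun t => t - c) @^-1` `]a, b]) = mu `]a, b].
Proof.
have -> : (fun t => t - c) @^-1` `]a, b] = `]a + c, b + c]%classic.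
  by apply/seteqP; split=> t; rewrite /= !in_itv/= ltrBrDr lerBlDr.
rewrite !lebesgue_measure_itv/= !lte_fin ltrD2r.
by case: ifP => // _; rewrite -!EFinB; congr EFin; rewrite opprD addrACA subrr addr0.
Qed.

Lemma lebesgue_measure_reflect (c a b : R) :
  mu ((fun t => c - t) @^-1` `]a, b]) = mu `]a, b].
Proof.
(* Reflection exchanges the open and the closed end; the length formula is the same for both kinds
   of interval. *)
have -> : (fun t => c - t) @^-1` `]a, b] = `[c - b, c - a[%classic.
  by apply/seteqP; split=> t; rewrite /= !in_itv/= ltrBrDr lerBlDr
    ltrBrDr lerBlDr [t + a]addrC [t + b]addrC => /andP[-> ->].
rewrite !lebesgue_measure_itv/= !lte_fin ltrD2l ltrN2.
case: ifP => // _; rewrite -!EFinB; congr EFin.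
by rewrite opprB addrC addrA subrK.
Qed.

End shift_reflect.

(** * Complex-valued integrals *)

Section complex_integral.
Context {R : realType}.
Local Notation C := (R[i]%C).
Implicit Types z w : C.

Lemma ReD z w : complex.Re (z + w) = complex.Re z + complex.Re w.
Proof. by case: z; case: w. Qed.

Lemma ImD z w : complex.Im (z + w) = complex.Im z + complex.Im w.
Proof. by case: z; case: w. Qed.

Lemma ReN z : complex.Re (- z) = - complex.Re z.
Proof. by case: z. Qed.

Lemma ImN z : complex.Im (- z) = - complex.Im z.
Proof. by case: z. Qed.

Lemma ReM z w : complex.Re (z * w) =
  complex.Re z * complex.Re w - complex.Im z * complex.Im w.
Proof. by case: z; case: w. Qed.

Lemma ImM z w : complex.Im (z * w) =
  complex.Re z * complex.Im w + complex.Im z * complex.Re w.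
Proof. by case: z; case: w. Qed.

Lemma complex_ext z w :
  complex.Re z = complex.Re w -> complex.Im z = complex.Im w -> z = w.
Proof. by case: z => a b; case: w => c d /= -> ->. Qed.

Lemma cabsE z : cabs z = Normc.normc z.
Proof. by case: z. Qed.

Lemma cabs_ge0 z : 0 <= cabs z. Proof. exact: sqrtr_ge0. Qed.

Lemma cabs0 : cabs (0 : C) = 0.
Proof. by rewrite /cabs /= expr0n /= addr0 sqrtr0. Qed.

Lemma cabs1 : cabs (1 : C) = 1.
Proof. by rewrite /cabs /= expr1n expr0n /= addr0 sqrtr1. Qed.

Lemma cabsN z : cabs (- z) = cabs z.
Proof. by rewrite /cabs ReN ImN !sqrrN. Qed.

Lemma cabsM z w : cabs (z * w) = cabs z * cabs w.
Proof. by rewrite !cabsE Normc.normcM. Qed.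

Lemma cabsD z w : cabs (z + w) <= cabs z + cabs w.
Proof. by rewrite !cabsE le_normcD. Qed.

Lemma Re_le_cabs z : `|complex.Re z| <= cabs z.
Proof. by rewrite -sqrtr_sqr ler_wsqrtr// lerDl sqr_ge0. Qed.

Lemma Im_le_cabs z : `|complex.Im z| <= cabs z.
Proof. by rewrite -sqrtr_sqr ler_wsqrtr// lerDr sqr_ge0. Qed.

(** Compare squares: the square of the right-hand side has the additional nonnegative cross term. *)
Lemma cabs_le_ReIm z : cabs z <= `|complex.Re z| + `|complex.Im z|.
Proof.
rewrite -[leRHS]ger0_norm ?addr_ge0// -sqrtr_sqr ler_wsqrtr//.
by rewrite sqrrD !real_normK ?num_real// -addrA lerD2l lerDr mulrn_wge0 ?mulr_ge0.
Qed.

Section measurability.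
Context {d} {T : measurableType d} (m : {measure set T -> \bar R}).
Implicit Types (D : set T) (f g : T -> C).

Definition cmeasurable D f :=
  measurable_fun D (fun x => complex.Re (f x)) /\
  measurable_fun D (fun x => complex.Im (f x)).

(** This is [L1] over an arbitrary measure, so that it also applies to the product measure in
    Fubini's theorem; for Lebesgue measure the two are convertible. *)
Definition cintegrable D f :=
  m.-integrable D (fun x => (complex.Re (f x))%:E) /\
  m.-integrable D (fun x => (complex.Im (f x))%:E).

Lemma cmeasurable_cst D (c : C) : cmeasurable D (fun _ => c).
Proof. by split; exact: measurable_cst. Qed.

Lemma cmeasurableM D f g : cmeasurable D f -> cmeasurable D g ->
  cmeasurable D (fun x => f x * g x).
Proof.
move=> [f1 f2] [g1 g2]; split.
  by under eq_fun do rewrite ReM;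
    apply: measurable_funB; exact: measurable_funM.
by under eq_fun do rewrite ImM; apply: measurable_funD; exact: measurable_funM.
Qed.

Lemma measurable_cabs D f :
  cmeasurable D f -> measurable_fun D (fun x => cabs (f x)).
Proof.
move=> [f1 f2].
have msqrt : measurable_fun setT (@Num.sqrt R).
  by apply: continuous_measurable_fun => x; exact: sqrt_continuous.
by apply: (measurableT_comp msqrt); apply: measurable_funD; exact: measurable_funX.
Qed.

Lemma cintegrable_measurable D f : cintegrable D f -> cmeasurable D f.
Proof.
by move=> [/measurable_int f1 /measurable_int f2]; split;
  exact/measurable_EFinP.
Qed.

Lemma cintegrable_le D f (g : T -> R) :
  measurable D -> cmeasurable D f ->
  (forall x, D x -> cabs (f x) <= g x) -> m.-integrable D (EFin \o g) ->
  cintegrable D f.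
Proof.
move=> mD [f1 f2] fg gi; split.
- apply: (le_integrable mD _ _ gi) => [|x Dx]; first exact/measurable_EFinP.
  rewrite lee_fin (le_trans (Re_le_cabs _))// (le_trans (fg _ Dx))//.
  exact: ler_norm.
- apply: (le_integrable mD _ _ gi) => [|x Dx]; first exact/measurable_EFinP.
  rewrite lee_fin (le_trans (Im_le_cabs _))// (le_trans (fg _ Dx))//.
  exact: ler_norm.
Qed.

Lemma integrable_cabs D f : measurable D -> cintegrable D f ->
  m.-integrable D (EFin \o (fun x => cabs (f x))).
Proof.
move=> mD fi; have [f1 f2] := fi.
apply: (le_integrable mD _ _
  (integrableD mD (integrable_abse f1) (integrable_abse f2))).
  by apply/measurable_EFinP/measurable_cabs; exact: cintegrable_measurable.
move=> x Dx /=; rewrite lee_fin ger0_norm ?cabs_ge0// (le_trans (cabs_le_ReIm _))//.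
by rewrite [leRHS]ger0_norm ?addr_ge0.
Qed.

Lemma cintegrableD D f g : measurable D -> cintegrable D f -> cintegrable D g ->
  cintegrable D (fun x => f x + g x).
Proof.
move=> mD [f1 f2] [g1 g2]; split.
  by under eq_fun do rewrite ReD EFinD; exact: integrableD.
by under eq_fun do rewrite ImD EFinD; exact: integrableD.
Qed.

Lemma cintegrable_bounded_mul D f g (M : R) : measurable D ->
  cintegrable D f -> cmeasurable D g -> (forall x, D x -> cabs (g x) <= M) ->
  cintegrable D (fun x => f x * g x).
Proof.
move=> mD fi mg gM; apply: (cintegrable_le _ _ (fun x => cabs (f x) * M)) => //.
- by apply: cmeasurableM => //; exact: cintegrable_measurable.
- by move=> x Dx; rewrite cabsM ler_wpM2l ?cabs_ge0// gM.
- rewrite (_ : _ \o _ = ((EFin \o (fun x => cabs (f x))) \* cst M%:E)%E)//.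
  by apply: integrableZr => //; exact: integrable_cabs.
Qed.

Lemma cintegrableZ D f (c : C) : measurable D -> cintegrable D f ->
  cintegrable D (fun x => c * f x).
Proof.
move=> mD fi; under eq_fun do rewrite mulrC.
by apply: (cintegrable_bounded_mul _ _ _ (cabs c)) => //; exact: cmeasurable_cst.
Qed.

End measurability.

Lemma cmeasurable_comp {d1 d2} {T1 : measurableType d1} {T2 : measurableType d2}
    (f : T2 -> C) (p : T1 -> T2) :
  cmeasurable setT f -> measurable_fun setT p -> cmeasurable setT (fun x => f (p x)).
Proof.
move=> [f1 f2] mp.
by split; [exact: (measurableT_comp f1)|exact: (measurableT_comp f2)].
Qed.

End complex_integral.

(** * Fubini's theorem for real-valued iterated integrals *)

Section Rintegral_fubini.
Context {d1 d2} {T1 : measurableType d1} {T2 : measurableType d2} {R : realType}.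
Variable m1 : {sigma_finite_measure set T1 -> \bar R}.
Variable m2 : {sigma_finite_measure set T2 -> \bar R}.
Variable F : T1 * T2 -> R.
Hypothesis Fi : (m1 \x m2)%E.-integrable setT (EFin \o F).

(** [Rintegral] is the [fine] part of the extended integral, so the two agree only where the section
    is integrable, which is almost everywhere. *)
Let Rintegral_section1E : ae_eq m1 setT
  (fun x => (Rintegral m2 setT (fun y => F (x, y)))%:E)
  (fubini_F m2 (EFin \o F)).
Proof.
apply: filterS (ae_integrable1 Fi) => y Fy _.
exact/fineK/integrable_fin_num.
Qed.

Let measurable_Rintegral_section1 : measurable_fun setT
  (fun x => Rintegral m2 setT (fun y => F (x, y))).
Proof.
have mfine : measurable_fun [set: \bar R] fine by exact: fine_measurable.
exact: (measurableT_comp mfine (measurable_fubini_F Fi)).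
Qed.

Let Rintegral_section2E : ae_eq m2 setT
  (fun y => (Rintegral m1 setT (fun x => F (x, y)))%:E)
  (fubini_G m1 (EFin \o F)).
Proof.
apply: filterS (ae_integrable2 Fi) => y Fy _.
exact/fineK/integrable_fin_num.
Qed.

Lemma measurable_Rintegral_section2 : measurable_fun setT
  (fun y => Rintegral m1 setT (fun x => F (x, y))).
Proof.
have mfine : measurable_fun [set: \bar R] fine by exact: fine_measurable.
exact: (measurableT_comp mfine (measurable_fubini_G Fi)).
Qed.

Lemma integrable_Rintegral_section : m1.-integrable setT
  (fun x => (Rintegral m2 setT (fun y => F (x, y)))%:E).
Proof.
have /integrableP[mF Foo] := integrable_fubini_F Fi.
have /measurable_EFinP mI := measurable_Rintegral_section1.
apply/integrableP; split; first exact: mI.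
apply: le_lt_trans Foo; rewrite le_eqVlt; apply/orP; left; apply/eqP.
apply: ge0_ae_eq_integral => //; try exact: measurableT_comp.
by apply: filterS Rintegral_section1E => x /= fx _; rewrite -fx.
Qed.

(** Both inner integrals are replaced, up to a null set, by their extended-real versions, to which
    [Fubini] applies. *)
Lemma Rintegral_fubini :
  Rintegral m1 setT (fun x => Rintegral m2 setT (fun y => F (x, y))) =
  Rintegral m2 setT (fun y => Rintegral m1 setT (fun x => F (x, y))).
Proof.
congr fine.
have /measurable_EFinP mF := measurable_Rintegral_section1.
have /measurable_EFinP mG := measurable_Rintegral_section2.
rewrite (ae_eq_integral _ _ measurableT mF (measurable_fubini_F Fi) Rintegral_section1E).
rewrite (ae_eq_integral _ _ measurableT mG (measurable_fubini_G Fi) Rintegral_section2E).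
exact: Fubini.
Qed.

End Rintegral_fubini.

(** * Complex-valued Lebesgue integrals over the line *)

Section complex_lebesgue.
Context {R : realType}.
Local Notation C := (R[i]%C).
Local Notation mu := (@lebesgue_measure R).
Local Notation RT := (measurableTypeR R).
Implicit Types f g : RT -> C.

Lemma Re_cint (D : set R) f : complex.Re (cint D f) =
  Rintegral mu D (fun x => complex.Re (f x)).
Proof. by rewrite /cint ReD ReM /= !mul0r mul1r subr0 addr0. Qed.

Lemma Im_cint (D : set R) f : complex.Im (cint D f) =
  Rintegral mu D (fun x => complex.Im (f x)).
Proof. by rewrite /cint ImD ImM /= mul0r mul1r !add0r. Qed.

Lemma eq_cint (D : set RT) f g : {in D, f =1 g} -> cint D f = cint D g.
Proof.
by move=> fg; apply: complex_ext; rewrite ?Re_cint ?Im_cint;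
  apply: eq_Rintegral => x Dx; rewrite fg.
Qed.

Lemma cintD f g : L1 setT f -> L1 setT g ->
  cint setT (fun x => f x + g x) = cint setT f + cint setT g.
Proof.
move=> [f1 f2] [g1 g2]; apply: complex_ext.
- by rewrite Re_cint [in RHS]ReD !Re_cint -RintegralD//;
    under eq_Rintegral do rewrite ReD.
- by rewrite Im_cint [in RHS]ImD !Im_cint -RintegralD//;
    under eq_Rintegral do rewrite ImD.
Qed.

Lemma integrable_RZ (r : R) (f : RT -> R) :
  mu.-integrable setT (EFin \o f) -> mu.-integrable setT (EFin \o (fun x => r * f x)).
Proof.
move=> fi; rewrite (_ : _ \o _ = fun x => (r%:E * (EFin \o f) x)%E)//.
exact: integrableZl.
Qed.

Lemma cintZ (c : C) f : L1 setT f ->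
  cint setT (fun x => c * f x) = c * cint setT f.
Proof.
move=> [f1 f2]; apply: complex_ext.
- rewrite Re_cint [in RHS]ReM Re_cint Im_cint.
  rewrite -(@RintegralZl _ _ _ mu setT (fun x => complex.Re (f x)))//.
  rewrite -(@RintegralZl _ _ _ mu setT (fun x => complex.Im (f x)))//.
  rewrite -RintegralB//; try exact: integrable_RZ.
  by under eq_Rintegral do rewrite ReM.
- rewrite Im_cint [in RHS]ImM Re_cint Im_cint.
  rewrite -(@RintegralZl _ _ _ mu setT (fun x => complex.Re (f x)))//.
  rewrite -(@RintegralZl _ _ _ mu setT (fun x => complex.Im (f x)))//.
  rewrite -RintegralD//; try exact: integrable_RZ.
  by under eq_Rintegral do rewrite ImM.
Qed.

Lemma cintB f g : L1 setT f -> L1 setT g ->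
  cint setT (fun x => f x - g x) = cint setT f - cint setT g.
Proof.
move=> fi gi; rewrite -[in RHS]mulN1r -cintZ//.
under eq_cint do rewrite -mulN1r.
by rewrite cintD//; exact: cintegrableZ.
Qed.

(** Real and imaginary parts are estimated separately, whence the factor 2; it is harmless, since
    the bound serves only for domination and for small errors. *)
Lemma cabs_cint_le f : L1 setT f ->
  cabs (cint setT f) <= 2 * Rintegral mu setT (fun x => cabs (f x)).
Proof.
move=> fi; have [f1 f2] := fi.
have fc := integrable_cabs mu _ _ measurableT fi.
apply: (le_trans (cabs_le_ReIm _)); rewrite Re_cint Im_cint mulr_natl mulr2n.
apply: lerD; (apply: le_trans (le_normr_Rintegral _ _) _ => //);
  apply: le_Rintegral => //; try exact: integrable_norm.
- by move=> x _; exact: Re_le_cabs.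
- by move=> x _; exact: Im_le_cabs.
Qed.

Lemma ae_eq_cint f g : cmeasurable setT f -> cmeasurable setT g ->
  {ae mu, forall x, f x = g x} -> cint setT f = cint setT g.
Proof.
move=> [f1 f2] [g1 g2] fg; apply: complex_ext.
- rewrite !Re_cint; congr fine; apply: ae_eq_integral => //;
    try exact/measurable_EFinP.
  by apply: filterS fg => x -> _.
- rewrite !Im_cint; congr fine; apply: ae_eq_integral => //;
    try exact/measurable_EFinP.
  by apply: filterS fg => x -> _.
Qed.

Lemma L1_shift (c : R) f : L1 setT f -> L1 setT (fun t : R => f (t - c)).
Proof.
move=> [f1 f2]; split.
- exact: (integrable_comp_preserving (fun t : R => t - c) (measurable_subl c)
    (lebesgue_measure_shift c) _ f1).
- exact: (integrable_comp_preserving (fun t : R => t - c) (measurable_subl c)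
    (lebesgue_measure_shift c) _ f2).
Qed.

Lemma cint_shift (c : R) f : L1 setT f ->
  cint setT (fun t : R => f (t - c)) = cint setT f.
Proof.
move=> [f1 f2]; apply: complex_ext; rewrite ?Re_cint ?Im_cint; congr fine.
- exact: (integral_comp_preserving (fun t : R => t - c) (measurable_subl c)
    (lebesgue_measure_shift c) _ f1).
- exact: (integral_comp_preserving (fun t : R => t - c) (measurable_subl c)
    (lebesgue_measure_shift c) _ f2).
Qed.

Lemma cint_reflect (c : R) f : L1 setT f ->
  cint setT (fun t : R => f (c - t)) = cint setT f.
Proof.
move=> [f1 f2]; apply: complex_ext; rewrite ?Re_cint ?Im_cint; congr fine.
- exact: (integral_comp_preserving (fun t : R => c - t) (measurable_subr c)
    (lebesgue_measure_reflect c) _ f1).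
- exact: (integral_comp_preserving (fun t : R => c - t) (measurable_subr c)
    (lebesgue_measure_reflect c) _ f2).
Qed.

Section fubini.
Variable F : RT * RT -> C.
Hypothesis Fi : cintegrable (mu \x mu)%E setT F.

Lemma ae_L1_section : {ae mu, forall t : RT, L1 setT (fun s : RT => F (s, t))}.
Proof.
case: Fi => F1 F2.
by apply: filterS2 (ae_integrable2 F1) (ae_integrable2 F2) => t; split.
Qed.

Lemma L1_cint_section : L1 setT (fun s : RT => cint setT (fun t : RT => F (s, t))).
Proof.
case: Fi => F1 F2; split.
- under eq_fun do rewrite Re_cint.
  exact: (integrable_Rintegral_section mu mu (fun z => complex.Re (F z)) F1).
- under eq_fun do rewrite Im_cint.
  exact: (integrable_Rintegral_section mu mu (fun z => complex.Im (F z)) F2).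
Qed.

Lemma cint_fubini : cint setT (fun s : RT => cint setT (fun t : RT => F (s, t))) =
  cint setT (fun t : RT => cint setT (fun s : RT => F (s, t))).
Proof.
case: Fi => F1 F2; apply: complex_ext.
(* [rewrite Re_cint] would compare the two iterated integrals by conversion,
   which takes minutes. *)
- apply: etrans (Re_cint setT _) _; apply/esym.
  apply: etrans (Re_cint setT _) _; apply/esym.
  transitivity (Rintegral mu setT (fun s =>
      Rintegral mu setT (fun t => complex.Re (F (s, t))))).
    by apply: eq_Rintegral => s _; exact: Re_cint.
  rewrite (Rintegral_fubini mu mu (fun z => complex.Re (F z)) F1).
  by apply: eq_Rintegral => t _; exact/esym/Re_cint.
- apply: etrans (Im_cint setT _) _; apply/esym.
  apply: etrans (Im_cint setT _) _; apply/esym.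
  transitivity (Rintegral mu setT (fun s =>
      Rintegral mu setT (fun t => complex.Im (F (s, t))))).
    by apply: eq_Rintegral => s _; exact: Im_cint.
  rewrite (Rintegral_fubini mu mu (fun z => complex.Im (F z)) F2).
  by apply: eq_Rintegral => t _; exact/esym/Im_cint.
Qed.

Lemma cmeasurable_cint_section :
  cmeasurable setT (fun t : RT => cint setT (fun s : RT => F (s, t))).
Proof.
case: Fi => F1 F2; split.
- under eq_fun do rewrite Re_cint.
  exact: (measurable_Rintegral_section2 mu mu (fun z => complex.Re (F z)) F1).
- under eq_fun do rewrite Im_cint.
  exact: (measurable_Rintegral_section2 mu mu (fun z => complex.Im (F z)) F2).
Qed.

End fubini.
End complex_lebesgue.

(** * Convolution *)

Section convolution.
Context {R : realType}.
Local Notation C := (R[i]%C).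
Local Notation mu := (@lebesgue_measure R).
Local Notation RT := (measurableTypeR R).
(* Unqualified, [conv] is the convex combination of MathComp-Analysis. *)
Local Notation conv := Defs.conv.
Implicit Types f g h b : RT -> C.

Lemma cmeasurable_reflect (c : R) f :
  cmeasurable setT f -> cmeasurable setT (fun t : RT => f (c - t)).
Proof. by move=> mf; apply: cmeasurable_comp => //; exact: measurable_subr. Qed.

Lemma L1_cabs f : L1 setT f ->
  mu.-integrable setT (EFin \o (fun x => cabs (f x))).
Proof. exact: integrable_cabs. Qed.

Lemma L1_conv_integrand b (M : R) f x : cmeasurable setT b ->
  (forall t, cabs (b t) <= M) -> L1 setT f ->
  L1 setT (fun t : RT => f t * b (x - t)).
Proof.
move=> mb bM fi; apply: (cintegrable_bounded_mul _ _ _ _ M) => //.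
exact: cmeasurable_reflect.
Qed.

Lemma cabs_conv_le b (M : R) f x : cmeasurable setT b ->
  (forall t, cabs (b t) <= M) -> L1 setT f ->
  cabs (conv f b x) <= 2 * (M * norm1 f).
Proof.
move=> mb bM fi; have fbi := L1_conv_integrand b M f x mb bM fi.
apply: (le_trans (cabs_cint_le _ fbi)); rewrite ler_wpM2l//.
rewrite /norm1 -RintegralZl//; last exact: L1_cabs.
apply: le_Rintegral => //.
- exact: L1_cabs.
- by apply: integrable_RZ; exact: L1_cabs.
- by move=> t _; rewrite cabsM mulrC ler_wpM2r ?cabs_ge0.
Qed.

Lemma conv_linear b (M : R) (a : C) f g x : cmeasurable setT b ->
  (forall t, cabs (b t) <= M) -> L1 setT f -> L1 setT g ->
  conv (fun t => a * f t + g t) b x = a * conv f b x + conv g b x.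
Proof.
move=> mb bM fi gi; rewrite /conv -cintZ; last exact: L1_conv_integrand mb bM _.
rewrite -cintD.
- by apply: eq_cint => t _; rewrite mulrDl mulrA.
- by apply: cintegrableZ => //; exact: L1_conv_integrand mb bM _.
- exact: L1_conv_integrand mb bM _.
Qed.

(** This makes the integral itself a convolution with a bounded function, so that [conv_conv] also
    yields its multiplicativity. *)
Lemma conv_cst1 f x : conv f (fun _ => 1) x = cint setT f.
Proof. by apply: eq_cint => t _; rewrite mulr1. Qed.

Lemma measurable_sub_snd_fst :
  measurable_fun setT (fun z : RT * RT => (z.2 - z.1 : RT)).
Proof.
exact: (measurable_funB measurable_snd measurable_fst).
Qed.

(** Tonelli: integrating first in [t], translation invariance gives [norm1 f * cabs (g s)], which is
    integrable in [s]. *)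
Lemma integrable_conv_cabs g f : L1 setT g -> L1 setT f ->
  (mu \x mu)%E.-integrable setT
    (EFin \o (fun z : RT * RT => cabs (g z.1) * cabs (f (z.2 - z.1)))).
Proof.
move=> gi fi.
have [mg mf] : cmeasurable setT g /\ cmeasurable setT f.
  by split; apply: cintegrable_measurable; [exact: gi|exact: fi].
apply/integrable12ltyP.
  apply/measurable_EFinP/measurable_funM.
  - by apply: measurable_cabs; apply: cmeasurable_comp mg _.
  - apply: measurable_cabs; apply: cmeasurable_comp mf _.
    exact: measurable_sub_snd_fst.
rewrite (_ : (\int[mu]_x _)%E =
  (\int[mu]_x ((norm1 f)%:E * (cabs (g x))%:E))%E); last first.
  apply: eq_integral => s _.
  transitivity (\int[mu]_t ((cabs (g s))%:E * (cabs (f (t - s)))%:E))%E.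
    apply: eq_integral => t _ /=.
    by rewrite ger0_norm ?mulr_ge0 ?cabs_ge0.
  have fsi := L1_shift s _ fi.
  rewrite integralZl//; last exact: L1_cabs.
  rewrite muleC; congr (_ * _)%E.
  rewrite (integral_comp_preserving (fun t : R => t - s) (measurable_subl s)
    (lebesgue_measure_shift s) (fun t => (cabs (f t))%:E)); last exact: L1_cabs.
  by rewrite fineK//; exact: integrable_fin_num (L1_cabs _ fi).
rewrite integralZl//; last exact: L1_cabs.
apply: lte_mul_pinfty => //.
- by rewrite lee_fin; apply: Rintegral_ge0 => x _; exact: cabs_ge0.
- exact: integrable_lty (L1_cabs _ gi).
Qed.

Section conv_conv.
Variables (g f h b : RT -> C) (M : R).
Hypotheses (gi : L1 setT g) (fi : L1 setT f) (mh : cmeasurable setT h)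
  (hgf : {ae mu, forall x, h x = conv g f x})
  (mb : cmeasurable setT b) (bM : forall t, cabs (b t) <= M).

(** The bounded factor is left general for two uses: [b (x - z.2)] to exchange the integrals, and
    the constant 1 for the existence of [conv g f] almost everywhere. *)
Let cintegrable_convM (M' : R) (b' : RT * RT -> C) : cmeasurable setT b' ->
  (forall z, cabs (b' z) <= M') ->
  cintegrable (mu \x mu)%E setT
    (fun z : RT * RT => g z.1 * f (z.2 - z.1) * b' z).
Proof.
move=> mb' b'M.
apply: (cintegrable_le _ _ _
  (fun z : RT * RT => M' * (cabs (g z.1) * cabs (f (z.2 - z.1))))) => //.
- apply: cmeasurableM => //; apply: cmeasurableM.
    by apply: cmeasurable_comp => //; exact: cintegrable_measurable gi.
  apply: cmeasurable_comp; first exact: cintegrable_measurable fi.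
  exact: measurable_sub_snd_fst.
- by move=> z _; rewrite !cabsM mulrC ler_wpM2r ?mulr_ge0 ?cabs_ge0.
- exact: (integrableZl measurableT M' (integrable_conv_cabs g f gi fi)).
Qed.

(** Integrating over [z.1] first leads to [conv h b x]; integrating over [z.2] first leads to the
    convolution of [g] with [conv f b]. *)
Let F x (z : RT * RT) := g z.1 * f (z.2 - z.1) * b (x - z.2).

Let Fi x : cintegrable (mu \x mu)%E setT (F x).
Proof.
apply: (cintegrable_convM M (fun z => b (x - z.2))) => //.
exact: (cmeasurable_comp _ _ (cmeasurable_reflect x b mb) measurable_snd).
Qed.

(** Translate the variable of [conv f b (x - s)] by [s]: the argument [x - s - (t - s)] of [b]
    becomes [x - t]. *)
Let inner x s : cint setT (fun t => F x (s, t)) = g s * conv f b (x - s).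
Proof.
have fbi := L1_conv_integrand b M f (x - s) mb bM fi.
rewrite /conv -(cint_shift s _ fbi) -cintZ; last exact: (L1_shift s _ fbi).
apply: eq_cint => t _; rewrite /F /= mulrA; congr (_ * b _).
by rewrite opprB addrA subrK.
Qed.

(** By [inner] this function is a partial integral of the integrable [F x], hence integrable by
    Fubini. *)
Lemma L1_conv_conv x : L1 setT (fun s : RT => g s * conv f b (x - s)).
Proof.
have := L1_cint_section _ (Fi x).
by under eq_fun do rewrite inner.
Qed.

(** The integral defining [conv g f t] converges absolutely only for almost every [t]. *)
Let ae_gf : {ae mu, forall t : RT, L1 setT (fun s : RT => g s * f (t - s))}.
Proof.
(* The [eq_ind_r] term proves [cabs 1 <= 1]. *)
have gf1 := cintegrable_convM 1 (fun _ => 1) (cmeasurable_cst _ _)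
  (fun _ => eq_ind_r (fun r => r <= 1) (lexx 1) cabs1).
have := ae_L1_section _ gf1; apply: filterS => t.
by under eq_fun do rewrite mulr1.
Qed.

Lemma conv_conv x : conv h b x = cint setT (fun s => g s * conv f b (x - s)).
Proof.
rewrite -(eq_cint _ _ _ (fun s _ => inner x s)) (cint_fubini _ (Fi x)).
apply: ae_eq_cint.
- apply: cmeasurableM => //; exact: cmeasurable_reflect.
- exact: cmeasurable_cint_section.
(* Where [conv g f t] converges, the factor [b (x - t)], constant in [s], moves under its integral
   sign. *)
- apply: filterS2 hgf ae_gf => t -> gft; rewrite /F /conv mulrC -cintZ//.
  by apply: eq_cint => s _; rewrite mulrC.
Qed.

End conv_conv.
End convolution.

(** * Limits at infinity and the ideal of convergence *)

Section limits.
Context {R : realType}.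
Local Notation C := (R[i]%C).
Local Notation mu := (@lebesgue_measure R).
Local Notation RT := (measurableTypeR R).
Local Notation conv := Defs.conv.

(** The componentwise form unfolds to the convergence in [Ssum]; [ccvgP] supplies the modulus form
    used for closedness. *)
Definition ccvg (F : R -> C) (l : C) :=
  (complex.Re (F x) @[x --> +oo] --> complex.Re l) /\
  (complex.Im (F x) @[x --> +oo] --> complex.Im l).

Lemma ccvgP (F : R -> C) (l : C) : ccvg F l <->
  forall e : R, 0 < e -> \forall x \near +oo, cabs (F x - l) < e.
Proof.
split=> [[F1 F2] e e0|Fl].
- have e20 : 0 < e / 2 by rewrite divr_gt0.
  move/cvgrPdist_lt : F1 => /(_ _ e20) F1.
  move/cvgrPdist_lt : F2 => /(_ _ e20) F2.
  apply: filterS2 F1 F2 => x F1 F2.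
  apply: (le_lt_trans (cabs_le_ReIm _)).
  by rewrite ReD ImD ReN ImN (splitr e) ltrD// distrC.
- split; apply/cvgrPdist_lt => e e0; apply: filterS (Fl _ e0) => x;
    apply: le_lt_trans; rewrite distrC.
  + by have := Re_le_cabs (F x - l); rewrite ReD ReN.
  + by have := Im_le_cabs (F x - l); rewrite ImD ImN.
Qed.

Lemma ccvg_cst (l : C) : ccvg (fun _ => l) l.
Proof. by split; exact: cvg_cst. Qed.

Lemma ccvgD (F G : R -> C) (l k : C) : ccvg F l -> ccvg G k ->
  ccvg (fun x => F x + G x) (l + k).
Proof.
move=> [F1 F2] [G1 G2]; split.
- by rewrite ReD; under eq_fun do rewrite ReD; exact: cvgD.
- by rewrite ImD; under eq_fun do rewrite ImD; exact: cvgD.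
Qed.

Lemma ccvgM (F G : R -> C) (l k : C) : ccvg F l -> ccvg G k ->
  ccvg (fun x => F x * G x) (l * k).
Proof.
move=> [F1 F2] [G1 G2]; split.
- by rewrite ReM; under eq_fun do rewrite ReM; apply: cvgB; exact: cvgM.
- by rewrite ImM; under eq_fun do rewrite ImM; apply: cvgD; exact: cvgM.
Qed.

(** Dominated convergence concerns sequences, so the limit at infinity is tested along every
    sequence [u] tending to infinity. *)
Lemma Rintegral_dominated (F : RT -> R -> R) (F0 G : RT -> R) :
  (forall x, mu.-integrable setT (fun s => (F s x)%:E)) ->
  mu.-integrable setT (fun s => (F0 s)%:E) ->
  mu.-integrable setT (fun s => (G s)%:E) ->
  (forall s x, `|F s x| <= G s) ->
  (forall s, F s x @[x --> +oo] --> F0 s) ->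
  Rintegral mu setT (F^~ x) @[x --> +oo] --> Rintegral mu setT F0.
Proof.
move=> Fi F0i Gi FG FF0; apply/cvg_pinftyP => u uoo.
have Fu s : (F s (u n))%:E @[n --> \oo] --> (F0 s)%:E.
  apply/fine_cvgP; split; first exact: nearW.
  exact: (cvg_pinftyP _ _).1 (FF0 s) _ uoo.
have [_ _ dom] := @dominated_convergence _ RT R mu setT measurableT
  (fun n s => (F s (u n))%:E) (fun s => (F0 s)%:E) (fun s => (G s)%:E)
  (fun n => measurable_int _ (Fi (u n))) (measurable_int _ F0i)
  (aeW _ (fun s _ => Fu s))
  Gi (aeW _ (fun s n _ => FG s (u n))).
apply: fine_cvg.
by rewrite fineK; [exact: dom|exact: (integrable_fin_num measurableT F0i)].
Qed.

Lemma cvg_shiftry (F : R -> R) (l s : R) :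
  F x @[x --> +oo] --> l -> F (x - s) @[x --> +oo] --> l.
Proof.
move=> Fl; apply: (cvg_comp (fun x : R => x - s) F _ Fl).
apply/cvgryPge => A; near=> x.
by rewrite lerBrDr; near: x; apply: nbhs_pinfty_ge; exact: num_real.
Unshelve. all: by end_near. Qed.

(** For fixed [s] the translate [K (x - s)] still tends to [L], and [M * cabs (g s)] dominates the
    integrand for every [x]. *)
Lemma ccvg_dominated (g : RT -> C) (K : R -> C) (L : C) (M : R) :
  L1 setT g -> (forall x, L1 setT (fun s => g s * K (x - s))) ->
  (forall x, cabs (K x) <= M) -> ccvg K L ->
  ccvg (fun x => cint setT (fun s => g s * K (x - s))) (cint setT g * L).
Proof.
move=> gi gKi KM KL.
have gLi : L1 setT (fun s => g s * L).
  by under eq_fun do rewrite mulrC; exact: cintegrableZ.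
have Gi : mu.-integrable setT (fun s => (M * cabs (g s))%:E).
  by apply: (integrable_RZ M (fun s => cabs (g s))); exact: L1_cabs.
have gKM s x : cabs (g s * K (x - s)) <= M * cabs (g s).
  by rewrite cabsM mulrC ler_wpM2r ?cabs_ge0.
have gKL s : ccvg (fun x => g s * K (x - s)) (g s * L).
  apply: ccvgM; first exact: ccvg_cst.
  by case: KL => K1 K2; split; exact: (cvg_shiftry (fun x => _ (K x))).
have -> : cint setT g * L = cint setT (fun s => g s * L).
  by rewrite mulrC -cintZ//; apply: eq_cint => s _; rewrite mulrC.
split.
- under eq_fun do rewrite Re_cint; rewrite Re_cint.
  apply: (Rintegral_dominated (fun s x => complex.Re (g s * K (x - s))) _
    (fun s => M * cabs (g s))) => //.
  + by move=> x; exact: (gKi x).1.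
  + exact: gLi.1.
  + by move=> s x; exact: le_trans (Re_le_cabs _) (gKM s x).
  + by move=> s; exact: (gKL s).1.
- under eq_fun do rewrite Im_cint; rewrite Im_cint.
  apply: (Rintegral_dominated (fun s x => complex.Im (g s * K (x - s))) _
    (fun s => M * cabs (g s))) => //.
  + by move=> x; exact: (gKi x).2.
  + exact: gLi.2.
  + by move=> s x; exact: le_trans (Im_le_cabs _) (gKM s x).
  + by move=> s; exact: (gKL s).2.
Qed.

End limits.

Section convergence_ideal.
Context {R : realType}.
Local Notation C := (R[i]%C).
Local Notation mu := (@lebesgue_measure R).
Local Notation RT := (measurableTypeR R).
Local Notation conv := Defs.conv.

Definition convergence_ideal (b : RT -> C) (l : C) : set (R -> C) :=
  fun h => L1 setT h /\ ccvg (conv h b) (l * cint setT h).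

Lemma cint0 : cint setT (fun _ : RT => 0 : C) = 0.
Proof.
by apply: complex_ext; rewrite ?Re_cint ?Im_cint Rintegral_cst// mul0r.
Qed.

Lemma L1_0 : L1 setT (fun _ : R => 0 : C).
Proof. by split; exact: integrable0. Qed.

(** Take [b = 1] in [conv_conv]: every convolution with 1 is an integral. *)
Lemma cint_conv (g f h : RT -> C) : L1 setT g -> L1 setT f ->
  cmeasurable setT h -> {ae mu, forall x, h x = conv g f x} ->
  cint setT h = cint setT g * cint setT f.
Proof.
move=> gi fi mh hgf.
have le11 (t : RT) : cabs (1 : C) <= 1 by rewrite cabs1.
rewrite -(conv_cst1 h 0).
rewrite (conv_conv g f h _ 1 gi fi mh hgf (cmeasurable_cst _ _) le11).
rewrite [RHS]mulrC -cintZ//; apply: eq_cint => s _.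
by rewrite conv_cst1 mulrC.
Qed.

Lemma closed_convergence_ideal (b : RT -> C) (M : R) (l : C) :
  cmeasurable setT b -> (forall t, cabs (b t) <= M) ->
  closed_ideal (convergence_ideal b l).
Proof.
move=> mb bM.
have M0 : 0 <= M by exact: le_trans (cabs_ge0 _) (bM 0).
split.
- by move=> h [].
- split; first exact: L1_0.
  rewrite cint0 mulr0 (_ : conv _ _ = fun _ => 0); first exact: ccvg_cst.
  apply/funext => x; rewrite -[RHS]cint0.
  by apply: eq_cint => t _; rewrite mul0r.
- move=> a f g [fi fl] [gi gl].
  have afi : L1 setT (fun x => a * f x) by exact: cintegrableZ.
  split; first exact: cintegrableD.
  rewrite cintD// cintZ// mulrDr mulrCA.
  rewrite (_ : conv _ _ = fun x => a * conv f b x + conv g b x).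
    by apply: ccvgD => //; apply: ccvgM => //; exact: ccvg_cst.
  by apply/funext => x; exact: conv_linear mb bM fi gi.
- move=> f g h [fi fl] gi hi hgf.
  have mh : cmeasurable setT (h : RT -> C) by exact: cintegrable_measurable hi.
  split => //.
  (* Multiplicativity of the integral puts the limit in the form [cint setT g * (l * cint setT f)]
     that [ccvg_dominated] produces. *)
  rewrite (cint_conv g f h gi fi mh hgf) mulrCA.
  rewrite (_ : conv h b = fun x => cint setT (fun s => g s * conv f b (x - s))).
    apply: (ccvg_dominated _ _ _ (2 * (M * norm1 f))) => //.
    + by move=> x; exact: (L1_conv_conv g f b M gi fi mb bM).
    + by move=> x; exact: cabs_conv_le mb bM fi.
  by apply/funext => x; exact: (conv_conv g f h b M gi fi mh hgf mb bM).
- move=> h hi happrox; split => //; apply/ccvgP => e e0.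
  (* Replacing [h] by [f] costs at most [(2 * M + 2 * cabs l) * norm1 (h - f)], uniformly in [x];
     the summand 1 keeps [K] positive, so that one can divide by it. *)
  pose K := 2 * M + 2 * cabs l + 1.
  have K0 : 0 < K by rewrite ltr_wpDl// addr_ge0// mulr_ge0// cabs_ge0.
  have e20 : 0 < e / 2 by rewrite divr_gt0.
  have [f [fi fl] hf] := happrox (e / 2 / K) (divr_gt0 e20 K0).
  have /ccvgP /(_ _ e20) := fl; apply: filterS => x fx.
  have fNi : L1 setT (fun t => -1 * f t) by exact: cintegrableZ.
  have hfi : L1 setT (fun t => h t - f t).
    by under eq_fun do rewrite addrC -mulN1r; exact: cintegrableD.
  (* By linearity the deviation of [h] is that of [f], below [e / 2] for large [x], plus that of
     [h - f], at most [e / 2] for every [x]. *)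
  have -> : conv h b x - l * cint setT h =
      (conv f b x - l * cint setT f) +
      (conv (fun t => h t - f t) b x - l * cint setT (fun t => h t - f t)).
    rewrite cintB//.
    rewrite (_ : conv (fun t => h t - f t) b x = conv h b x - conv f b x).
      by rewrite mulrBr opprB addrACA [X in _ = X]addrA; ring.
    have := conv_linear b M (-1) f h x mb bM fi hi; rewrite mulN1r addrC => <-.
    by apply: eq_cint => t _; congr (_ * _); rewrite mulN1r addrC.
  apply: (le_lt_trans (cabsD _ _)); rewrite [ltRHS]splitr ltr_leD//.
  apply: (le_trans (cabsD _ _)); rewrite cabsN cabsM.
  have c1 := cabs_conv_le b M _ x mb bM hfi.
  have c2 := ler_wpM2l (cabs_ge0 l) (cabs_cint_le _ hfi).
  apply: (le_trans (lerD c1 c2)).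
  have -> : 2 * (M * norm1 (fun t => h t - f t)) +
      cabs l * (2 * norm1 (fun t => h t - f t)) =
      (2 * M + 2 * cabs l) * norm1 (fun t => h t - f t) by ring.
  have n0 : 0 <= norm1 (fun t => h t - f t).
    by apply: Rintegral_ge0 => t _; exact: cabs_ge0.
  apply: (@le_trans _ _ (K * norm1 (fun t => h t - f t))).
    by rewrite ler_wpM2r// lerDl.
  by rewrite mulrC -ler_pdivlMr// ltW.
Qed.

End convergence_ideal.

(** * Functions on the half-line and their extensions by zero *)

Section half_line.
Context {R : realType}.
Local Notation C := (R[i]%C).
Local Notation mu := (@lebesgue_measure R).
Local Notation RT := (measurableTypeR R).
Local Notation conv := Defs.conv.
Implicit Types f phi : RT -> C.

Let mitv : measurable (`[(0 : R), +oo[%classic : set RT).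
Proof. exact: measurable_itv. Qed.

Lemma Re_ext0 f : (fun x => complex.Re (ext0 f x)) =
  (fun x => complex.Re (f x)) \_ `[0, +oo[.
Proof.
apply/funext => x; rewrite patchE mem_setE in_itv/= andbT /ext0.
by case: (0 <= x).
Qed.

Lemma Im_ext0 f : (fun x => complex.Im (ext0 f x)) =
  (fun x => complex.Im (f x)) \_ `[0, +oo[.
Proof.
apply/funext => x; rewrite patchE mem_setE in_itv/= andbT /ext0.
by case: (0 <= x).
Qed.

Lemma L1_ext0 phi : L1 `[0, +oo[ phi -> L1 setT (ext0 phi).
Proof.
move=> [phi1 phi2]; split.
- rewrite (_ : (fun _ => _) = EFin \o (fun x => complex.Re (ext0 phi x)))//.
  rewrite Re_ext0 -restrict_EFin.
  exact: ((integrable_mkcond _ mitv).1 phi1).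
- rewrite (_ : (fun _ => _) = EFin \o (fun x => complex.Im (ext0 phi x)))//.
  rewrite Im_ext0 -restrict_EFin.
  exact: ((integrable_mkcond _ mitv).1 phi2).
Qed.

Lemma cint_ext0 phi : cint setT (ext0 phi) = cint `[0, +oo[ phi.
Proof.
apply: complex_ext.
- by rewrite !Re_cint Re_ext0 -Rintegral_mkcond.
- by rewrite !Im_cint Im_ext0 -Rintegral_mkcond.
Qed.

Lemma cmeasurable_ext0 f :
  cmeasurable (`[0, +oo[%classic : set RT) f -> cmeasurable setT (ext0 f : RT -> C).
Proof.
move=> [f1 f2]; split.
- rewrite Re_ext0; exact: ((measurable_restrictT _ mitv).1 f1).
- rewrite Im_ext0; exact: ((measurable_restrictT _ mitv).1 f2).
Qed.

(** The extension of [f] imposes [0 <= t] and that of [phi] imposes [t <= x], so the product lives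
    on the interval of integration. *)
Lemma Sconv_ext0 phi f x :
  Sconv phi f x = cint setT (fun t => ext0 f t * ext0 phi (x - t)).
Proof.
(* [P] stands for the real or the imaginary part; [P 0 = 0] makes it commute with truncation. *)
have E (P : C -> R) : P 0 = 0 ->
  (fun t => P (f t * phi (x - t))) \_ `[0, x] =
  (fun t => P (ext0 f t * ext0 phi (x - t))).
  move=> P0; apply/funext => t; rewrite patchE mem_setE in_itv/= /ext0 subr_ge0.
  by case: (0 <= t); case: (t <= x); rewrite /= ?mulr0 ?mul0r ?P0.
by apply: complex_ext; rewrite ?Re_cint ?Im_cint Rintegral_mkcond E.
Qed.

(** The essential bound becomes a pointwise one by setting [ext0 f] to zero off [B], which changes
    it on a null set only. [b] is chosen before [phi], so the same [b] serves both kernels of the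
    theorem. *)
Lemma Sconv_bounded f : Linf_pos f -> exists (b : RT -> C) (M : R),
  [/\ cmeasurable setT b, forall t, cabs (b t) <= M &
    forall phi, L1 `[0, +oo[ phi -> Sconv phi f = conv (ext0 phi) b].
Proof.
move=> [f1 [f2 [M fM]]].
have mf : cmeasurable setT (ext0 f : RT -> C) by exact: cmeasurable_ext0.
pose B := [set t : RT | cabs (ext0 f t) <= M].
have mB : measurable B.
  have -> : B = setT `&` (fun t => cabs (ext0 f t)) @^-1` `]-oo, M]%classic.
    by rewrite setTI; apply/seteqP; split => t; rewrite /B /= in_itv.
  exact: (measurable_cabs _ _ mf measurableT _ (measurable_itv _)).
pose b t := if t \in B then ext0 f t else 0.
have bE (P : C -> R) : P 0 = 0 -> (fun t => P (b t)) = (fun t => P (ext0 f t)) \_ B.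
  by move=> P0; apply/funext => t; rewrite patchE /b; case: ifP.
have mb : cmeasurable setT b.
  split.
  - rewrite bE//; apply/(measurable_restrictT _ mB).
    exact: measurable_funS mf.1.
  - rewrite bE//; apply/(measurable_restrictT _ mB).
    exact: measurable_funS mf.2.
(* The absolute value also covers the points where [b] is 0, without a proof that [M] is
   nonnegative. *)
have bM t : cabs (b t) <= `|M|.
  rewrite /b; case: ifPn => [|_]; last by rewrite cabs0.
  by rewrite inE /B /= => /le_trans; apply; exact: ler_norm.
exists b, `|M|; split => // phi phii; apply/funext => x.
have phiE := L1_ext0 phi phii.
have mphi : cmeasurable setT (ext0 phi : RT -> C) by exact: cintegrable_measurable phiE.
have xxK t : x - (x - t) = t by exact: subKr.
(* [Sconv] evaluates the kernel at [x - t] but [conv] evaluates it at [t]; the reflection of [t]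
   about [x] matches them. *)
rewrite Sconv_ext0 /conv
  -(cint_reflect x _ (L1_conv_integrand b `|M| (ext0 phi) x mb bM phiE)).
apply: ae_eq_cint.
- by apply: cmeasurableM => //; exact: cmeasurable_reflect.
- rewrite (_ : (fun _ => _) = fun t => ext0 phi (x - t) * b t).
    by apply: cmeasurableM => //; exact: cmeasurable_reflect.
  by apply/funext => t; rewrite xxK.
- apply: (@filterS _ _ (ae_filter_ringOfSetsType mu) _ _ _ fM) => t ft.
  rewrite xxK mulrC; congr (_ * _).
  (* Off [B], either [t < 0] and both sides are 0, or [0 <= t] and the bound [ft] is
     contradicted. *)
  rewrite /b; case: ifPn => //; rewrite notin_setE /B /= /ext0.
  case: ifPn => // t0 []; apply: ft.
  by rewrite /= in_itv/= t0.
Qed.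

End half_line.

Theorem theorem3p3 (R : realType) (phi phi' : R -> R[i]%C) :
  L1 `[0, +oo[ phi -> L1 `[0, +oo[ phi' ->
  cint `[0, +oo[ phi = 1 -> cint `[0, +oo[ phi' = 1 ->
  gen_ideal (ext0 phi) `<=` gen_ideal (ext0 phi') ->
  stronger phi phi'.
Proof.
move=> phii phi'i phi1 phi'1 sub f /Sconv_bounded[b [M [mb bM fb]]] l Sl.
(* As [phi] has integral 1, the limit in the ideal's condition is [l] itself. *)
suff [_] : convergence_ideal b l (ext0 phi).
  by rewrite cint_ext0 phi1 mulr1 /Ssum fb.
(* [ext0 phi] lies in its own generated ideal, hence by [sub] in every closed ideal that contains
   [ext0 phi']. *)
apply: (sub (ext0 phi)) => [J _ //||].
  exact: closed_convergence_ideal mb bM.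
split; first exact: L1_ext0.
by rewrite cint_ext0 phi'1 mulr1 -fb.
Qed.
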